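(* Let $p$ be a prime, and let $P$ and $Q$ be finite groups belonging to the class $CP_2$, of the same order and of the same exponent $p^m$. Let $t\ge 0$ be an integer with $t+1\le m$, and suppose that $|\Omega_{m-i}(P)|=|\Omega_{m-i}(Q)|$ for $i=1,2,\dots,t$ (a vacuous condition if $t=0$). If $|\Omega_{m-t-1}(P)|<|\Omega_{m-t-1}(Q)|$, then $\psi(P)>\psi(Q)$.
   Context: For a finite group $G$ and $x\in G$, $o(x)$ is the order of $x$, and $\psi(G)=\sum_{x\in G}o(x)$. $CP_2$ is the class of finite groups $G$ such that $o(xy)\le\max\{o(x),o(y)\}$ for all $x,y\in G$. For a finite $p$-group $G$ and an integer $i\ge 0$, $\Omega_i(G)=\langle\{x\in G : x^{p^i}=1\}\rangle$ is the subgroup generated by all $x\in G$ with $x^{p^i}=1$ (so $\Omega_0(G)=1$). Groups of exponent $p^m$ are $p$-groups. *)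

(* Defs.v *)
From mathcomp Require Import all_boot all_fingroup all_solvable.

Set Implicit Arguments.
Unset Strict Implicit.
Unset Printing Implicit Defensive.

Local Open Scope group_scope.

Definition psi (gT : finGroupType) (G : {set gT}) : nat :=
  (\sum_(x in G) #[x])%N.

Definition in_CP2 (gT : finGroupType) (G : {set gT}) : Prop :=
  forall x y, x \in G -> y \in G -> #[x * y] <= maxn #[x] #[y].

(* Omega_i(G) is MathComp's 'Ohm_i(G).  Its definition reads the prime off
   each element (as pdiv #[x]); when G is a p-group, OhmE identifies it with
   the subgroup generated by the x in G such that x ^+ (p ^ i) = 1. *)

(* Main.v *)
Require Import Defs.
From mathcomp Require Import all_boot all_fingroup all_solvable.
From mathcomp Require Import zify.

Set Implicit Arguments.
Unset Strict Implicit.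
Unset Printing Implicit Defensive.

Local Open Scope group_scope.

(** In a [p]-group of class CP_2 the elements of order at most [p ^ j] form a
    subgroup, so ['Ohm_j(G)] is exactly the set of these elements
    ([mem_Ohm_CP2]), and the orders of the Omega subgroups determine how many
    elements there are of each order.

    To isolate the contribution of the elements of large order, replace every
    order smaller than [p ^ j] by [p ^ j]: the truncated sum [psi_above]
    telescopes in [j], its increments being multiples of [#|'Ohm_j(G)|]
    ([psi_above_step]).  With
    [k = m - t - 1], all Omega subgroups above level [k] have the same order in
    [P] and [Q], so both groups have the same truncated sum [D] at threshold
    [p ^ k.+1].  Write [a] and [b] for the orders of the [k]-th Omega subgroups
    of [P] and [Q].  Undoing the truncation only lowers the orders of the
    elements of these subgroups: it lowers [D] by at most [(p ^ k.+1 - 1) * a]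
    in [P], as an order is at least 1, and by at least [(p ^ k.+1 - p ^ k) * b]
    in [Q], as the orders there are at most [p ^ k].  Since [a < b] are powers
    of [p], [b >= p * a], and so [(p ^ k.+1 - p ^ k) * b >= p ^ k.+1 * a]:
    [Q] loses more than [P]. *)

Definition psi_above (gT : finGroupType) (G : {set gT}) (n : nat) : nat :=
  (\sum_(x in G) maxn #[x] n)%N.

Lemma dvdn_pexp_leq (p n i : nat) :
  prime p -> p.-nat n -> (n %| p ^ i)%N = (n <= p ^ i)%N.
Proof.
move=> p_pr /p_natP[l ->]; have p_gt1 := prime_gt1 p_pr.
by rewrite dvdn_Pexp2l // leq_exp2l.
Qed.

(** The maximum condition makes the elements of order at most [p ^ i] closed
    under products, so they already are the subgroup that they generate. *)
Lemma mem_Ohm_CP2 (p : nat) (gT : finGroupType) (G : {group gT}) (i : nat) :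
    prime p -> p.-group G -> in_CP2 G ->
  forall x, x \in G -> (x \in 'Ohm_i(G)) = (#[x] <= p ^ i)%N.
Proof.
move=> p_pr pG cp2 x Gx.
have Ldiv_order y : y \in G -> (y \in 'Ldiv_(p ^ i)(G)) = (#[y] <= p ^ i)%N.
  move=> Gy; rewrite !inE Gy /= -order_dvdn dvdn_pexp_leq //.
  exact: mem_p_elt pG Gy.
have gL : group_set 'Ldiv_(p ^ i)(G).
  apply/group_setP; split=> [|y z Ly Lz].
    by rewrite Ldiv_order // order1 expn_gt0 prime_gt0.
  have [Gy Gz] : y \in G /\ z \in G by case/setIP: Ly; case/setIP: Lz.
  rewrite Ldiv_order ?groupM //; apply: leq_trans (cp2 y z Gy Gz) _.
  by rewrite geq_max -!Ldiv_order // Ly.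
rewrite (OhmE _ pG) -Ldiv_order //.
by rewrite -[in LHS]/(gval (Group gL)) genGid.
Qed.

Lemma sum_mem_card (gT : finGroupType) (A B : {set gT}) :
  B \subset A -> (\sum_(x in A) (x \in B) = #|B|)%N.
Proof.
move=> sBA; rewrite -sum1_card -big_mkcondr /=.
by apply: eq_bigl => x; rewrite andb_idl // => /(subsetP sBA).
Qed.

(** Orders are powers of [p], so raising the threshold from [p ^ j] to
    [p ^ j.+1] affects only the elements of order at most [p ^ j]. *)
Lemma psi_above_step (p : nat) (gT : finGroupType) (G : {group gT}) (j : nat) :
    prime p -> p.-group G -> in_CP2 G ->
  (psi_above G (p ^ j) + (p ^ j.+1 - p ^ j) * #|'Ohm_j(G)|
     = psi_above G (p ^ j.+1))%N.
Proof.
move=> p_pr pG cp2; have p_gt1 := prime_gt1 p_pr.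
rewrite -(sum_mem_card (Ohm_sub j G)) big_distrr -big_split /=.
apply: eq_bigr => x Gx; rewrite (mem_Ohm_CP2 j p_pr pG cp2 Gx).
have /p_natP[l ->] : p.-elt x := mem_p_elt pG Gx.
have le_exp : (p ^ j <= p ^ j.+1)%N by rewrite leq_exp2l.
rewrite leq_exp2l //; case: leqP => [le_lj | lt_jl].
  have : (p ^ l <= p ^ j)%N by rewrite leq_exp2l.
  lia.
have : (p ^ j.+1 <= p ^ l)%N by rewrite leq_exp2l.
lia.
Qed.

(** Descending induction on the threshold, from [p ^ m], at which every element
    contributes [p ^ m]. *)
Lemma eq_psi_above (p : nat) (gT rT : finGroupType)
    (P : {group gT}) (Q : {group rT}) (m j : nat) :
    prime p -> p.-group P -> p.-group Q -> in_CP2 P -> in_CP2 Q ->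
    #|P| = #|Q| -> exponent P %| p ^ m -> exponent Q %| p ^ m ->
    (j <= m)%N ->
    (forall i, (j <= i < m)%N -> #|'Ohm_i(P)| = #|'Ohm_i(Q)|) ->
  psi_above P (p ^ j) = psi_above Q (p ^ j).
Proof.
move=> p_pr pP pQ cpP cpQ eqPQ expP expQ le_jm.
have top (hT : finGroupType) (G : {group hT}) :
    exponent G %| p ^ m -> (psi_above G (p ^ m) = #|G| * p ^ m)%N.
  move=> expG; rewrite -sum_nat_const; apply: eq_bigr => x Gx.
  apply/maxn_idPr/dvdn_leq; first by rewrite expn_gt0 prime_gt0.
  exact: dvdn_trans (dvdn_exponent Gx) expG.
rewrite -(subKn le_jm); elim: (m - j)%N (leq_subr j m) => [|d IHd] lt_dm eqO.
  by rewrite subn0 !top // eqPQ.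
have eS : (m - d.+1).+1 = (m - d)%N by rewrite subnSK.
have := psi_above_step (m - d.+1) p_pr pP cpP.
have := psi_above_step (m - d.+1) p_pr pQ cpQ.
rewrite eS (eqO (m - d.+1)%N); last lia.
rewrite IHd ?(ltnW lt_dm) // => [<- /addIn //|i /andP[le_di lt_im]].
by apply: eqO; rewrite lt_im andbT; apply: leq_trans le_di; rewrite leq_sub2l.
Qed.

Lemma psi_le_above (gT : finGroupType) (G : {set gT}) (n : nat) :
  (psi G <= psi_above G n)%N.
Proof. by apply: leq_sum => x _; apply: leq_maxl. Qed.

(** Truncation raises only the orders of elements of ['Ohm_k(G)], each by at
    most [p ^ k - 1] since orders are positive. *)
Lemma psi_above_le (p : nat) (gT : finGroupType) (G : {group gT}) (k : nat) :
    prime p -> p.-group G -> in_CP2 G ->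
  (psi_above G (p ^ k) + #|'Ohm_k(G)| <= psi G + p ^ k * #|'Ohm_k(G)|)%N.
Proof.
move=> p_pr pG cp2.
rewrite -(sum_mem_card (Ohm_sub k G)) big_distrr -!big_split /=.
apply: leq_sum => x Gx; rewrite (mem_Ohm_CP2 k p_pr pG cp2 Gx).
have := order_gt0 x; case: leqP; lia.
Qed.

Lemma pnat_ltn_leq_mul (p a b : nat) :
  prime p -> p.-nat a -> p.-nat b -> (a < b)%N -> (p * a <= b)%N.
Proof.
move=> p_pr /p_natP[u ->] /p_natP[v ->]; have p_gt1 := prime_gt1 p_pr.
by rewrite ltn_exp2l // -expnS leq_exp2l.
Qed.

Theorem theorem1p3 (p : nat) (gT rT : finGroupType)
    (P : {group gT}) (Q : {group rT}) (m t : nat)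
    (p_prime : prime p)
    (CP2_P : in_CP2 P) (CP2_Q : in_CP2 Q)
    (eq_card : #|P| = #|Q|)
    (exp_P : exponent P = (p ^ m)%N) (exp_Q : exponent Q = (p ^ m)%N)
    (lt_t_m : (t + 1 <= m)%N)
    (eq_Ohm : forall i : nat, (1 <= i <= t)%N ->
       #|'Ohm_(m - i)(P)| = #|'Ohm_(m - i)(Q)|)
    (lt_Ohm : (#|'Ohm_(m - t - 1)(P)| < #|'Ohm_(m - t - 1)(Q)|)%N) :
  (psi P > psi Q)%N.
Proof.
have p_gt1 := prime_gt1 p_prime.
have pP : p.-group P by rewrite -pnat_exponent exp_P pnatX pnat_id.
have pQ : p.-group Q by rewrite -pnat_exponent exp_Q pnatX pnat_id.
set k := (m - t - 1)%N in lt_Ohm.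
have eqD : psi_above P (p ^ k.+1) = psi_above Q (p ^ k.+1).
  apply: (@eq_psi_above p _ _ P Q m) => //; rewrite ?exp_P ?exp_Q //; first lia.
  move=> i lt_kim; have -> : i = (m - (m - i))%N by lia.
  by apply: eq_Ohm; lia.
have stepP := psi_above_step k p_prime pP CP2_P.
have stepQ := psi_above_step k p_prime pQ CP2_Q.
have lowP := psi_above_le k p_prime pP CP2_P.
have upQ := psi_le_above Q (p ^ k).
have := cardG_gt0 'Ohm_k(P).
have : (p * #|'Ohm_k(P)| <= #|'Ohm_k(Q)|)%N.
  by apply: pnat_ltn_leq_mul lt_Ohm => //; apply: pgroupS (Ohm_sub k _) _.
move: stepP stepQ lowP upQ; rewrite eqD expnS.
move: #|'Ohm_k(P)| #|'Ohm_k(Q)| => a b stepP stepQ lowP upQ le_pa_b a_gt0.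
(* The factor [p - 1] in [p ^ k.+1 - p ^ k] may be 1, so [a < b] would not be
   enough here: the factor [p] in [p * a <= b] is what compensates. *)
have loss : (p * p ^ k * a <= (p * p ^ k - p ^ k) * b)%N.
  rewrite -[X in (_ - X)%N]mul1n -mulnBl (mulnC p) (mulnC (p - 1)%N) -!mulnA.
  apply: leq_mul (leqnn _) (leq_trans le_pa_b _).
  by rewrite leq_pmull // subn_gt0.
have split_p : ((p * p ^ k - p ^ k) * a + p ^ k * a = p * p ^ k * a)%N.
  by rewrite -mulnDl subnK // leq_pmull // ltnW.
lia.
Qed.
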